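(* If $P$ is a Dedekind Poisson algebra over an arbitrary field, then $[P,P]\subseteq P^2$.
   Context: A Poisson algebra over a field $F$ is an $F$-vector space $P$ with a bilinear commutative associative multiplication $xy$ (no identity element is assumed) and an alternating Lie bracket $[\,,\,]$ ($[x,x]=0$ for all $x$) satisfying $[xy,z]=x[y,z]+y[x,z]$. A Poisson subalgebra is a subspace closed under both operations; a Poisson ideal is a subspace $I$ with $PI\subseteq I$ and $[P,I]\subseteq I$. A Poisson algebra is Dedekind if every Poisson subalgebra is a Poisson ideal. $P^2$ is the linear span of all products $xy$ ($x,y\in P$) and $[P,P]$ is the linear span of all brackets $[x,y]$ ($x,y\in P$). No finite-dimensionality is assumed. *)

(* Defs.v *)
From HB Require Import structures.
From mathcomp Require Import all_boot all_order all_algebra.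
From mathcomp Require Import classical_sets.

Set Implicit Arguments.
Unset Strict Implicit.
Unset Printing Implicit Defensive.

Import GRing.Theory.

Local Open Scope ring_scope.
Local Open Scope classical_set_scope.

(* The commutative product is not assumed to have an identity, so a Poisson
   algebra is built on an lmodType rather than on a ring type. *)
HB.mixin Record Lmodule_isPoisson (F : fieldType) P of GRing.Lmodule F P := {
  pmul : P -> P -> P;
  pbracket : P -> P -> P;
  pmul_bilinear : bilinear_for *:%R *:%R pmul;
  pmulC : commutative pmul;
  pmulA : associative pmul;
  pbracket_bilinear : bilinear_for *:%R *:%R pbracket;
  pbracketxx : forall x, pbracket x x = 0;
  pbracket_jacobi : forall x y z,
    pbracket x (pbracket y z) + pbracket y (pbracket z x)
      + pbracket z (pbracket x y) = 0;
  pbracket_leibniz : forall x y z,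
    pbracket (pmul x y) z = pmul x (pbracket y z) + pmul y (pbracket x z)
}.

#[short(type="poissonType")]
HB.structure Definition Poisson (F : fieldType) :=
  {P of Lmodule_isPoisson F P & GRing.Lmodule F P}.

Definition is_subspace (F : fieldType) (V : lmodType F) (A : set V) : Prop :=
  submod_closed (mem A).

Definition lspan (F : fieldType) (V : lmodType F) (A : set V) : set V :=
  [set v | exists (n : nat) (c : 'I_n -> F) (u : 'I_n -> V),
     (forall i, A (u i)) /\ v = \sum_(i < n) c i *: u i].

Section PoissonSubsets.
Variables (F : fieldType) (P : poissonType F).

Definition poisson_subalgebra (A : set P) : Prop :=
  [/\ is_subspace A,
      forall x y, A x -> A y -> A (pmul x y) &
      forall x y, A x -> A y -> A (pbracket x y)].

Definition poisson_ideal (I : set P) : Prop :=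
  [/\ is_subspace I,
      forall x y, I y -> I (pmul x y) &
      forall x y, I y -> I (pbracket x y)].

Definition product_space : set P :=
  lspan [set pmul x y | x in [set: P] & y in [set: P]].

Definition bracket_space : set P :=
  lspan [set pbracket x y | x in [set: P] & y in [set: P]].

End PoissonSubsets.

Definition dedekind (F : fieldType) (P : poissonType F) : Prop :=
  forall A : set P, poisson_subalgebra A -> poisson_ideal A.

Arguments product_space {F} P.
Arguments bracket_space {F} P.

(* Main.v *)
Require Import Defs.
From mathcomp Require Import all_boot all_order all_algebra.
From mathcomp Require Import classical_sets.

Local Open Scope classical_set_scope.

Import GRing.Theory.
Local Open Scope ring_scope.

(** Modulo P^2 the multiplication vanishes, so for every x the subspace
    F x + P^2 is a Poisson subalgebra ([subalgebra_line_add_product]); when P is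
    Dedekind it is an ideal, whence [y, x] is congruent to a scalar multiple
    a x.  Exchanging the roles of x and y, [x, y] is congruent to some b y.  By
    antisymmetry a x + b y lies in P^2.  If a = 0 then [y, x] is in P^2;
    otherwise x is proportional to y modulo P^2, and [x, y] is in P^2 because
    [y, y] = 0 and P^2 is stable under brackets.  That stability
    ([product_bracket]) is the Leibniz rule. *)

Lemma subspaceP (F : fieldType) (V : lmodType F) (A : set V) :
  is_subspace A <-> A 0 /\ forall a u v, A u -> A v -> A (a *: u + v).
Proof.
split=> [[A0 Alin]|[A0 Alin]]; split.
- by move: A0; rewrite in_setE.
- by move=> a u v Au Av; rewrite -in_setE; apply: Alin; rewrite in_setE.
- by rewrite in_setE.
- by move=> a u v; rewrite !in_setE; apply: Alin.
Qed.

Lemma lspan_subspace (F : fieldType) (V : lmodType F) (A : set V) :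
  is_subspace (lspan A).
Proof.
apply/subspaceP; split=> [|a _ _ [m [c [u [Au ->]]]] [n [d [w [Aw ->]]]]].
  exists 0%N, (fun=> 0), (fun=> 0); split; first by case.
  by rewrite big_ord0.
exists (m + n)%N,
  (fun i => match split i with inl j => a * c j | inr j => d j end),
  (fun i => match split i with inl j => u j | inr j => w j end).
split=> [i|]; first by case: (split i).
rewrite big_split_ord scaler_sumr /=; congr (_ + _); apply: eq_bigr => i _.
  by rewrite (unsplitK (inl _ i)) scalerA.
by rewrite (unsplitK (inr _ i)).
Qed.

Lemma sub_lspan {F : fieldType} {V : lmodType F} {A : set V} {v : V} :
  A v -> lspan A v.
Proof.
by move=> Av; exists 1%N, (fun=> 1), (fun=> v); rewrite big_ord1 scale1r.
Qed.

Lemma lspan_min (F : fieldType) (V : lmodType F) (A B : set V) :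
  is_subspace B -> A `<=` B -> lspan A `<=` B.
Proof.
move=> /subspaceP[B0 Blin] AB _ [n [c [u [Au ->]]]].
elim/big_ind: _ => // [x y Bx By|i _].
  by rewrite -[x]scale1r; apply: Blin.
by rewrite -[_ *: _]addr0; apply: Blin => //; apply: AB.
Qed.

Section Poisson.
Variables (F : fieldType) (P : poissonType F).
Implicit Types (x y z p : P) (a : F).

Lemma pbracketPl z a x y :
  pbracket (a *: x + y) z = a *: pbracket x z + pbracket y z.
Proof. by case: (pbracket_bilinear (s := P)) => + _; apply. Qed.

Lemma pbracketPr z a x y :
  pbracket z (a *: x + y) = a *: pbracket z x + pbracket z y.
Proof. by case: (pbracket_bilinear (s := P)) => _; apply. Qed.

Lemma pbracket0r x : pbracket x 0 = 0.
Proof.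
by have := pbracketPr x (-1) 0 0; rewrite !scaleN1r oppr0 addr0 addNr.
Qed.

Lemma pbracketC x y : pbracket x y = - pbracket y x.
Proof.
have := pbracketxx (1 *: x + y).
rewrite pbracketPl !pbracketPr !pbracketxx !scale1r add0r addr0.
by move/eqP; rewrite addr_eq0 => /eqP.
Qed.

Lemma product_lin a x y :
  product_space P x -> product_space P y -> product_space P (a *: x + y).
Proof.
by have /subspaceP[_] :=
  lspan_subspace _ _ [set pmul x y | x in [set: P] & y in [set: P]]; apply.
Qed.

Lemma product0 : product_space P 0.
Proof.
by have /subspaceP[] :=
  lspan_subspace _ _ [set pmul x y | x in [set: P] & y in [set: P]].
Qed.

Lemma product_scale a x : product_space P x -> product_space P (a *: x).
Proof.
by move=> Px; rewrite -[_ *: _]addr0; apply: product_lin => //; apply: product0.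
Qed.

Lemma product_opp x : product_space P x -> product_space P (- x).
Proof. by rewrite -scaleN1r; apply: product_scale. Qed.

Lemma product_add x y :
  product_space P x -> product_space P y -> product_space P (x + y).
Proof. by rewrite -{2}[x]scale1r; apply: product_lin. Qed.

Lemma product_pmul x y : product_space P (pmul x y).
Proof. by apply: sub_lspan; exists x => //; exists y. Qed.

(** Leibniz rule: bracketing a product gives a sum of two products. *)
Lemma product_bracket z p :
  product_space P p -> product_space P (pbracket z p).
Proof.
move: p; apply: (lspan_min _ _ _ [set p | product_space P (pbracket z p)]).
  apply/subspaceP; split=> [|a x y /= Px Py].
    by rewrite /= pbracket0r; apply: product0.
  by rewrite pbracketPr; apply: product_lin.
move=> _ [x _ [y _ <-]] /=; rewrite pbracketC pbracket_leibniz.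
by apply/product_opp/product_add; apply: product_pmul.
Qed.

Definition line_add_product x : set P :=
  [set v | exists a, product_space P (v - a *: x)].

(** Products fall into P^2, and among the brackets of elements a x + p and
    b x + q the only term not obviously in P^2 is a b [x, x] = 0. *)
Lemma subalgebra_line_add_product x : poisson_subalgebra (line_add_product x).
Proof.
have in_line v : product_space P v -> line_add_product x v.
  by exists 0; rewrite scale0r subr0.
split.
- apply/subspaceP; split; first by apply/in_line/product0.
  move=> c u v [a Pu] [b Pv]; exists (c * a + b).
  by rewrite scalerDl -scalerA opprD addrACA -scalerBr; apply: product_lin.
- by move=> u v _ _; apply/in_line/product_pmul.
- move=> u v [a Pu] [b Pv]; apply: in_line.
  rewrite -(subrK (b *: x) v) addrC pbracketPr.
  apply: product_add; last exact: product_bracket.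
  rewrite -(subrK (a *: x) u) addrC pbracketPl pbracketxx scaler0 add0r.
  by rewrite pbracketC; apply/product_scale/product_opp/product_bracket.
Qed.

Lemma dedekind_bracket_line x y :
  dedekind P -> exists a, product_space P (pbracket y x - a *: x).
Proof.
move=> /(_ _ (subalgebra_line_add_product x)) [_ _]; apply.
by exists 1; rewrite scale1r subrr; apply: product0.
Qed.

Lemma dedekind_bracket x y : dedekind P -> product_space P (pbracket y x).
Proof.
move=> dedP.
have [a Pa] := dedekind_bracket_line x y dedP.
have [b Pb] := dedekind_bracket_line y x dedP.
have [a0|a_neq0] := eqVneq a 0; first by move: Pa; rewrite a0 scale0r subr0.
(* Adding the two congruences cancels the brackets: a x + b y is in P^2. *)
have Pab : product_space P (a *: x + b *: y).
  have := product_opp _ (product_add _ _ Pa Pb).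
  by rewrite (pbracketC x y) addrACA subrr add0r opprD !opprK.
(* Bracketing with y leaves a [y, x], because [y, y] = 0. *)
have := product_scale a^-1 _ (product_bracket y _ Pab).
rewrite -[b *: y]addr0 !pbracketPr pbracketxx pbracket0r scaler0 !addr0.
by rewrite scalerA mulVf // scale1r.
Qed.

End Poisson.

Theorem proposition2p6 (F : fieldType) (P : poissonType F) :
  dedekind P -> bracket_space P `<=` product_space P.
Proof.
move=> dedP; apply: lspan_min; first exact: lspan_subspace.
by move=> _ [x _ [y _ <-]]; apply: dedekind_bracket.
Qed.
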